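(* Let $F_{\underline{312}}(x,t,z)=\sum_{n\ge0}\sum_{\pi\in\mathbf I_n(3412)}x^n t^{\mathrm{occ}_{312}(\pi)}z^{\mathrm{fix}(\pi)}$. Then $aF_{\underline{312}}^2+bF_{\underline{312}}+c=0$, where $a=x^3zt+x^2-x^3z$, $b=xz+x^2+x^3z-x^3zt-x^2-1$, and $c=1$.
   Context: $\mathbf I_n(3412)$ is the set of involutions of $\{1,\dots,n\}$ with no subsequence order-isomorphic to $3412$. $\mathrm{occ}_{312}(\pi)$ is the number of indices $i$ such that $\pi_i\pi_{i+1}\pi_{i+2}$ is order-isomorphic to $312$, and $\mathrm{fix}(\pi)$ is the number of fixed points. *)

(* Defs.v *)
From mathcomp Require Import all_boot all_order all_fingroup all_algebra.
From mathcomp Require Import mpoly.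

Set Implicit Arguments.
Unset Strict Implicit.
Unset Printing Implicit Defensive.

Import GRing.Theory.

Definition order_iso (u v : seq nat) : bool :=
  (size u == size v) &&
  [forall i : 'I_(size u), forall j : 'I_(size u),
     (nth 0 u i < nth 0 u j) == (nth 0 v i < nth 0 v j)].

Definition contains_3412 (n : nat) (s : 'S_n) : bool :=
  [exists i : 'I_n, exists j : 'I_n, exists k : 'I_n, exists l : 'I_n,
     [&& i < j, j < k, k < l &
         order_iso [:: val (s i); val (s j); val (s k); val (s l)]
                   [:: 3; 4; 1; 2]]].

Definition I3412 (n : nat) : {set 'S_n} :=
  [set s : 'S_n | [forall i, s (s i) == i] && ~~ contains_3412 s].

(* Consecutive occurrences: j and k are the positions i+1 and i+2. *)
Definition occ312 (n : nat) (s : 'S_n) : nat :=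
  #|[set i : 'I_n | [exists j : 'I_n, exists k : 'I_n,
       [&& val j == i.+1, val k == i.+2 &
           order_iso [:: val (s i); val (s j); val (s k)] [:: 3; 1; 2]]]]|.

Definition fixpts (n : nat) (s : 'S_n) : nat := #|[set i : 'I_n | s i == i]|.

Local Open Scope ring_scope.

(* Formal power series in x over R, represented by their coefficients. *)
Definition fps (R : Type) : Type := nat -> R.

Definition fps_mul (R : nzRingType) (f g : fps R) : fps R :=
  fun n => \sum_(i < n.+1) f i * g (n - i)%N.

Definition fps_of_poly (R : nzRingType) (p : {poly R}) : fps R :=
  fun n => p`_n.

(* Z[t, z] *)
Definition Ztz : comNzRingType := {mpoly int[2]}.
Definition t_var : Ztz := 'X_ord0.
Definition z_var : Ztz := 'X_ord_max.

(* F_312 as an element of Z[t, z][[x]]. *)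
Definition F312 : fps Ztz :=
  fun n => \sum_(s in I3412 n) t_var ^+ occ312 s * z_var ^+ fixpts s.

(* Main.v *)
Require Import Defs.
From mathcomp Require Import all_boot all_order all_fingroup all_algebra.
From mathcomp Require Import zify ring mpoly.

Set Implicit Arguments.
Unset Strict Implicit.
Unset Printing Implicit Defensive.

Import GRing.Theory.

(* In an involution the 3412-avoiding condition says that the 2-cycles do not
   cross, so a nonempty involution in I_n(3412) either fixes the first point,
   followed by a smaller involution, or opens with a 2-cycle (1 k) enclosing an
   involution u and followed by an involution v. The latter has the consecutive
   312's of u and of v, plus one starting at position 1 exactly when u begins
   with an ascent, i.e. when u has length at least 2 and fixes its first point.
   Hence F = 1 + xzF + x^2 F (F + (t - 1) xz (F - 1)). *)

(** * Patterns as chains of inequalities *)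

Lemma order_iso_3412 a b c d :
  order_iso [:: a; b; c; d] [:: 3; 4; 1; 2] = [&& c < d, d < a & a < b].
Proof.
rewrite /order_iso /=; apply/forallP/idP => [H | /and3P[cd da ab]].
  (* The letters of 3412 increase along the positions 2, 3, 0, 1, so comparing neighbours in this
     order is enough. *)
  have /forallP/(_ (@Ordinal 4 3 isT))/eqP/= := H (@Ordinal 4 2 isT).
  have /forallP/(_ (@Ordinal 4 0 isT))/eqP/= := H (@Ordinal 4 3 isT).
  by have /forallP/(_ (@Ordinal 4 1 isT))/eqP/= := H (@Ordinal 4 0 isT) => -> -> ->.
case=> [[|[|[|[|i]]]] //= ilt]; apply/forallP => -[[|[|[|[|j]]]] //= jlt];
  by apply/eqP; lia.
Qed.

Lemma order_iso_312 a b c :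
  order_iso [:: a; b; c] [:: 3; 1; 2] = (b < c) && (c < a).
Proof.
rewrite /order_iso /=; apply/forallP/idP => [H | /andP[bc ca]].
  have /forallP/(_ (@Ordinal 3 2 isT))/eqP/= := H (@Ordinal 3 1 isT).
  by have /forallP/(_ (@Ordinal 3 0 isT))/eqP/= := H (@Ordinal 3 2 isT) => -> ->.
case=> [[|[|[|i]]] //= ilt]; apply/forallP => -[[|[|[|j]]] //= jlt];
  by apply/eqP; lia.
Qed.

(** * Involutions as words, and the two ways to build them *)

(** One-line notation on [0, ..., size w - 1]. Lists of naturals let words of different lengths be
    cut and glued without casts between ordinal types. *)
Definition inv3412_word (w : seq nat) : Prop :=
  [/\ forall i, i < size w -> nth 0 w i < size w,
      forall i, i < size w -> nth 0 w (nth 0 w i) = i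
    & forall i j k l, i < j -> j < k -> k < l -> l < size w ->
      nth 0 w k < nth 0 w l -> nth 0 w l < nth 0 w i ->
      nth 0 w i < nth 0 w j -> False].

Definition fixed_word (w : seq nat) : seq nat := 0 :: map S w.

(** The 2-cycle exchanging positions [0] and [(size u).+1], with [u] strictly inside it and [v]
    after it. *)
Definition arc_word (u v : seq nat) : seq nat :=
  (size u).+1 :: map S u ++ 0 :: map (addn (size u).+2) v.

Lemma size_fixed_word w : size (fixed_word w) = (size w).+1.
Proof. by rewrite /= size_map. Qed.

Lemma size_arc_word u v : size (arc_word u v) = (size u + size v).+2.
Proof. by rewrite /= size_cat /= !size_map addnS. Qed.

Lemma nth_fixed_word w i : i < size w ->
  nth 0 (fixed_word w) i.+1 = (nth 0 w i).+1.
Proof. by move=> lti; rewrite /= (nth_map 0). Qed.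

Lemma nth_arc_word_inner u v i : i < size u ->
  nth 0 (arc_word u v) i.+1 = (nth 0 u i).+1.
Proof. by move=> lti; rewrite /= nth_cat size_map lti (nth_map 0). Qed.

Lemma nth_arc_word_close u v : nth 0 (arc_word u v) (size u).+1 = 0.
Proof. by rewrite /= nth_cat size_map ltnn subnn. Qed.

Lemma nth_arc_word_outer u v i : i < size v ->
  nth 0 (arc_word u v) ((size u).+2 + i) = (size u).+2 + nth 0 v i.
Proof.
move=> lti; rewrite addSn /= nth_cat size_map ifN; last by lia.
by rewrite (_ : (size u).+1 + i - size u = i.+1) /= ?(nth_map 0) //; lia.
Qed.

Lemma arc_word_index u v i : i < size (arc_word u v) ->
  [\/ i = 0, exists2 a, a < size u & i = a.+1, i = (size u).+1
    | exists2 a, a < size v & i = (size u).+2 + a].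
Proof.
rewrite size_arc_word; case: i => [|i] lti; first by constructor 1.
have [ltu|] := ltnP i (size u); first by constructor 2; exists i.
rewrite leq_eqVlt => /orP[/eqP <-|gtu]; first by constructor 3.
by constructor 4; exists (i - (size u).+1); lia.
Qed.

Lemma inv3412_fixed_word w : inv3412_word w -> inv3412_word (fixed_word w).
Proof.
case=> wlt winv wav; split; rewrite size_fixed_word.
- by case=> [|i] lti //; rewrite nth_fixed_word //; apply: wlt.
- case=> [|i] lti //.
  by rewrite (nth_fixed_word lti) nth_fixed_word ?winv //; apply: wlt.
- case=> [|i] [|j] [|k] [|l] // ij jk kl ln.
  by rewrite !nth_fixed_word; first (by apply: (wav i j k l)); lia.
Qed.

(** The block of positions up to [(size u).+1] is stable ([inE]). A 3412 starting beyond it lies in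
    [v]. One starting in it has its last letter below its first, hence lies wholly in the block; it
    cannot use the opening letter as its 3, that letter being the largest of the block, nor the
    closing letter 0 as its 2. So it lies in [u]. *)
Lemma inv3412_arc_word u v :
  inv3412_word u -> inv3412_word v -> inv3412_word (arc_word u v).
Proof.
case=> ult uinv uav [vlt vinv vav].
have inE i : i < size (arc_word u v) ->
    (nth 0 (arc_word u v) i <= (size u).+1) = (i <= (size u).+1).
  move/arc_word_index=> [->|[a alt ->]|->|[a alt ->]].
  - by rewrite /= leqnn.
  - by rewrite nth_arc_word_inner //; have := ult a alt; lia.
  - by rewrite nth_arc_word_close leqnn.
  - by rewrite nth_arc_word_outer //; lia.
split.
- move=> i /arc_word_index; rewrite size_arc_word => -[->|[a alt ->]|->|[a alt ->]].
  + by rewrite /=; lia.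
  + by rewrite nth_arc_word_inner //; have := ult a alt; lia.
  + by rewrite nth_arc_word_close.
  + by rewrite nth_arc_word_outer //; have := vlt a alt; lia.
- move=> i /arc_word_index => -[->|[a alt ->]|->|[a alt ->]].
  + by rewrite [X in nth _ _ X]/= nth_arc_word_close.
  + by rewrite (nth_arc_word_inner _ alt) nth_arc_word_inner ?uinv ?ult.
  + by rewrite nth_arc_word_close.
  + by rewrite (nth_arc_word_outer _ alt) nth_arc_word_outer ?vinv ?vlt.
- move=> i j k l ij jk kl ln.
  have [iin|iout] := leqP i (size u).+1; last first.
    rewrite size_arc_word in ln.
    have shift a : i <= a -> exists b, a = (size u).+2 + b.
      by move=> ia; exists (a - (size u).+2); lia.
    have [[i' Ei] [j' Ej]] := (shift i (leqnn i), shift j (ltnW ij)).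
    have [k' Ek] : exists b, k = (size u).+2 + b by apply: shift; lia.
    have [l' El] : exists b, l = (size u).+2 + b by apply: shift; lia.
    rewrite Ei Ej Ek El !nth_arc_word_outer ?ltn_add2l; try lia.
    by apply: vav; lia.
  move=> wkl wli wij.
  have [lE kE] := (inE l ln, inE k (ltn_trans kl ln)).
  have [jE iE] : (nth 0 (arc_word u v) j <= (size u).+1) = (j <= (size u).+1)
      /\ (nth 0 (arc_word u v) i <= (size u).+1) = (i <= (size u).+1).
    by split; apply: inE; lia.
  have i0 : i <> 0.
    move=> i0; have W0 : nth 0 (arc_word u v) i = (size u).+1 by rewrite i0.
    lia.
  have lu : l <> (size u).+1.
    by move=> E; move: wkl; rewrite E nth_arc_word_close.
  case: i j k l ij jk kl {ln inE} iin wkl wli wij lE kE jE iE i0 lu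
    => [|i] [|j] [|k] [|l] // ij jk kl iin wkl wli wij lE kE jE iE i0 lu.
  have lltu : l < size u by lia.
  move: wkl wli wij; rewrite !nth_arc_word_inner; try lia.
  by apply: uav; lia.
Qed.

(** * Decomposition according to the first letter *)

Lemma inv3412_word_head0 w : inv3412_word (0 :: w) ->
  exists2 w', inv3412_word w' & 0 :: w = fixed_word w'.
Proof.
move=> [wlt winv wav].
(* Only position 0 carries the letter 0, so [predn] never truncates below. *)
have wpos i : i < size w -> nth 0 w i = (nth 0 w i).-1.+1.
  move=> lti; case E: (nth 0 w i) => [|//].
  by have := winv i.+1 lti; rewrite /= E.
have nthE i : i < size w -> nth 0 (map predn w) i = (nth 0 w i).-1.
  by move=> lti; rewrite (nth_map 0).
exists (map predn w); last first.
  congr (_ :: _); rewrite -map_comp -[LHS]map_id; apply: (eq_from_nth (x0 := 0)).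
    by rewrite !size_map.
  by move=> i; rewrite size_map => lti; rewrite !(nth_map 0) //= -wpos.
split; rewrite size_map.
- by move=> i lti; rewrite nthE //; have := wlt i.+1 lti; rewrite /= [nth 0 w i]wpos.
- move=> i lti; have := wlt i.+1 lti; have := winv i.+1 lti.
  rewrite /= [nth 0 w i]wpos //= => wi ltwi.
  by rewrite (nthE i) // nthE ?wi.
- move=> i j k l ij jk kl ln; rewrite !nthE; try lia.
  have := wav i.+1 j.+1 k.+1 l.+1 ij jk kl ln.
  move: (wpos i) (wpos j) (wpos k) (wpos l) => /=; lia.
Qed.

(** No 2-cycle crosses the arc from [0] to [m.+1], so the positions inside it and those after it are
    each stable. *)
Lemma inv3412_word_headS m w : inv3412_word (m.+1 :: w) ->
  exists u, exists v, [/\ inv3412_word u, inv3412_word v &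
    m.+1 :: w = arc_word u v].
Proof.
set W := m.+1 :: w => -[wlt winv wav].
have W0 : nth 0 W 0 = m.+1 by [].
have mlt : m.+1 < size W by rewrite -W0; apply: wlt.
have Wm : nth 0 W m.+1 = 0 by rewrite -W0 winv.
have inj i j : i < size W -> j < size W -> nth 0 W i = nth 0 W j -> i = j.
  by move=> li lj E; rewrite -(winv i) // E winv.
have inner i : 0 < i -> i < m.+1 -> 0 < nth 0 W i < m.+1.
  move=> i0 im; have li : i < size W by lia.
  have [E|n0] := posnP (nth 0 W i).
    have := inj i m.+1 li mlt; rewrite Wm E; lia.
  have nm : nth 0 W i <> m.+1 by move=> E; have := inj i 0 li isT; rewrite W0 E; lia.
  rewrite ltnNge; apply/negP => mle.
  (* A 2-cycle leaving the arc gives a 3412: these four positions carry the letters [m.+1],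
     [nth 0 W i], [0], [i]. *)
  apply: (wav 0 i m.+1 (nth 0 W i)) => //; rewrite ?winv ?W0 ?Wm //; try lia.
  exact: wlt.
have outer i : m.+1 < i -> i < size W -> m.+1 < nth 0 W i.
  move=> im li; rewrite ltnNge; apply/negP => le.
  have [E|n0] := posnP (nth 0 W i).
    by have := inj i m.+1 li mlt; rewrite Wm E; lia.
  have [E|nm] := eqVneq (nth 0 W i) m.+1.
    by have := inj i 0 li isT; rewrite W0 E; lia.
  (* A letter strictly inside the arc is itself an inner position, whose image [i] would have to be
     inside as well. *)
  by have := inner (nth 0 W i) n0; rewrite winv //; lia.
(* By [inner] and [outer], neither the predecessor nor the subtraction truncates. *)
set u := mkseq (fun i => (nth 0 W i.+1).-1) m.
set v := mkseq (fun i => nth 0 W (m.+2 + i) - m.+2) (size W - m.+2).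
have su : size u = m by rewrite size_mkseq.
have sv : size v = size W - m.+2 by rewrite size_mkseq.
have uE i : i < m -> nth 0 W i.+1 = (nth 0 u i).+1.
  by move=> im; rewrite nth_mkseq //; have := inner i.+1 isT im; lia.
have vE i : i < size W - m.+2 -> nth 0 W (m.+2 + i) = m.+2 + nth 0 v i.
  move=> im; rewrite nth_mkseq //; have := outer (m.+2 + i).
  by move: (nth 0 W (m.+2 + i)); lia.
exists u, v; split.
- split; rewrite su.
  + by move=> i im; have := inner i.+1 isT im; rewrite uE.
  + move=> i im; have := winv i.+1; have := inner i.+1 isT im.
    by rewrite uE // => ui; rewrite uE //; lia.
  + move=> i j k l ij jk kl lm; have := wav i.+1 j.+1 k.+1 l.+1 ij jk kl.
    by rewrite !uE; lia.
- split; rewrite sv.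
  + move=> i im; have := wlt (m.+2 + i).
    by rewrite vE //; lia.
  + move=> i im; have := winv (m.+2 + i); have := wlt (m.+2 + i).
    rewrite (vE i) // => lt; rewrite vE //; lia.
  + move=> i j k l ij jk kl lm.
    have := wav (m.+2 + i) (m.+2 + j) (m.+2 + k) (m.+2 + l).
    by rewrite !vE; lia.
- apply: (eq_from_nth (x0 := 0)); first by rewrite size_arc_word su sv; lia.
  move=> i li; have := @arc_word_index u v i.
  rewrite size_arc_word su sv => -[|->|[a alt ->]|->|[a alt ->]].
  + lia.
  + by rewrite /= su.
  + by rewrite nth_arc_word_inner ?su // uE.
  + by rewrite Wm -su nth_arc_word_close.
  + by rewrite -[m in RHS]su nth_arc_word_outer ?su ?sv // vE.
Qed.

(** * The two statistics on words *)

Fixpoint occ312_word (w : seq nat) : nat :=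
  if w is a :: r then
    (if r is b :: c :: _ then nat_of_bool ((b < c) && (c < a)) else 0) + occ312_word r
  else 0.

(** The offset [o] is the position of the first letter, so that a block of a longer word can be
    counted on its own. *)
Fixpoint fix_word (o : nat) (w : seq nat) : nat :=
  if w is a :: r then (a == o) + fix_word o.+1 r else 0.

Definition initial_ascent (w : seq nat) : bool :=
  if w is b :: c :: _ then b < c else false.

Lemma occ312_word_count w : occ312_word w =
  count (fun i => [&& i.+2 < size w, nth 0 w i.+1 < nth 0 w i.+2
                    & nth 0 w i.+2 < nth 0 w i]) (iota 0 (size w)).
Proof.
elim: w => //= a r ->; rewrite -(addn0 1) iotaDl count_map; congr (_ + _).
by case: r => [|b [|c r]].
Qed.

Lemma fix_word_count o w :
  fix_word o w = count (fun i => nth 0 w i == o + i) (iota 0 (size w)).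
Proof.
elim: w o => //= a r IH o; rewrite IH addn0 -(addn0 1) iotaDl count_map.
by congr (_ + _); apply: eq_count => i /=; rewrite add1n addnS.
Qed.

Lemma occ312_word_map (f : nat -> nat) w :
  {mono f : x y / x < y} -> occ312_word (map f w) = occ312_word w.
Proof.
by move=> fM; elim: w => //= a r ->; case: r => [|b [|c r]] //=; rewrite !fM.
Qed.

Lemma occ312_word0 w : occ312_word (0 :: w) = occ312_word w.
Proof. by case: w => [|b [|c r]] //=; rewrite andbF. Qed.

(** No 312 uses the separating 0: it is too small to be the 3 or the 2, and as the 1 it would need a
    following letter, at least [m], below a letter of [u]. *)
Lemma occ312_word_cat0 m u v : all (gtn m) u ->
  occ312_word (u ++ 0 :: map (addn m) v) = occ312_word u + occ312_word v.
Proof.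
elim: u => [_|a u IH /andP[am um]].
  by rewrite cat0s occ312_word0 occ312_word_map // => x y; rewrite ltn_add2l.
rewrite [LHS]/= IH // [occ312_word (a :: u)]/= -addnA; congr (_ + _).
case: u um {IH} => [_|b [|c u]] //=; case: v => [|d v] //=.
by move: am => /= am; lia.
Qed.

Lemma fix_word_shift p o w : fix_word (p + o) (map (addn p) w) = fix_word o w.
Proof. by elim: w o => //= a w IH o; rewrite eqn_add2l -addnS IH. Qed.

Lemma fix_word_cat o u v :
  fix_word o (u ++ v) = fix_word o u + fix_word (o + size u) v.
Proof. by elim: u o => [|a u IH] o /=; rewrite ?addn0 // IH addnA addSnnS. Qed.

Lemma occ312_fixed_word w : occ312_word (fixed_word w) = occ312_word w.
Proof. by rewrite occ312_word0 occ312_word_map. Qed.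

Lemma fix_fixed_word w : fix_word 0 (fixed_word w) = (fix_word 0 w).+1.
Proof. by rewrite /= (fix_word_shift 1 0). Qed.

(* No consecutive 312 straddles the closing letter 0 or the outer block, so the
   only new occurrence can start at the opening letter of the arc. *)
Lemma occ312_arc_word u v : all (gtn (size u)) u ->
  occ312_word (arc_word u v) = initial_ascent u + occ312_word u + occ312_word v.
Proof.
move=> ult; rewrite /arc_word -cat_cons occ312_word_cat0; last first.
  rewrite /= ltnSn all_map; apply: sub_all ult => a /=.
  by rewrite !ltnS; apply: ltnW.
rewrite [in LHS]/= occ312_word_map //; congr (_ + _ + _).
case: u ult => [|b [|c u]] //= /and3P[_ ltc _].
by move: ltc => /= ltc; lia.
Qed.

Lemma fix_arc_word u v :
  fix_word 0 (arc_word u v) = fix_word 0 u + fix_word 0 v.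
Proof.
rewrite /= fix_word_cat (fix_word_shift 1 0) /= size_map add1n.
by have := fix_word_shift (size u).+2 0 v; rewrite addn0 => ->.
Qed.

(** The first letter reveals the length of [u], hence where to cut. *)
Lemma arc_word_inj u v u' v' :
  arc_word u v = arc_word u' v' -> u = u' /\ v = v'.
Proof.
case=> su /eqP; rewrite eqseq_cat ?size_map // => /andP[/eqP/inj_map uu].
rewrite su => /eqP[/inj_map vv]; split; first by apply: uu => a b [].
by apply: vv => a b /addnI.
Qed.

(** * From permutations to words, and their recursive enumeration *)

Definition word n (s : 'S_n) : seq nat := [seq val (s i) | i <- enum 'I_n].

Lemma size_word n (s : 'S_n) : size (word s) = n.
Proof. by rewrite size_map size_enum_ord. Qed.

Lemma nth_word n (s : 'S_n) (i : 'I_n) : nth 0 (word s) i = s i.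
Proof. by rewrite (nth_map i) ?size_enum_ord // nth_ord_enum. Qed.

Lemma word_inj n : injective (@word n).
Proof.
move=> s s' E; apply/permP => i; apply: val_inj.
by rewrite /= -!nth_word E.
Qed.

Lemma card_ord_count n (P : pred 'I_n) (Q : pred nat) :
  (forall i : 'I_n, P i = Q i) -> #|[set i | P i]| = count Q (iota 0 n).
Proof.
move=> PQ; rewrite -sum1_count -[n in iota 0 n]subn0 -/(index_iota 0 n).
rewrite big_mkord -sum1_card; apply: eq_bigl => i.
by rewrite inE PQ.
Qed.

Lemma occ312_wordE n (s : 'S_n) : occ312 s = occ312_word (word s).
Proof.
rewrite occ312_word_count size_word; apply: card_ord_count => i.
apply/existsP/and3P => [[j /existsP[k /and3P[/eqP Ej /eqP Ek]]]|[lti H1 H2]].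
  rewrite order_iso_312 -Ek -Ej !nth_word => /andP[H1 H2]; split=> //.
  exact: ltn_ord.
exists (Ordinal (ltnW lti)); apply/existsP; exists (Ordinal lti).
by rewrite order_iso_312 /= -!nth_word !eqxx /= H1.
Qed.

Lemma fixpts_wordE n (s : 'S_n) : fixpts s = fix_word 0 (word s).
Proof.
rewrite fix_word_count size_word; apply: card_ord_count => i.
by rewrite nth_word.
Qed.

Definition words n : seq (seq nat) := [seq word s | s <- enum (I3412 n)].

Lemma uniq_words n : uniq (words n).
Proof. by rewrite map_inj_uniq ?enum_uniq //; apply: word_inj. Qed.

Lemma mem_words n w : w \in words n <-> size w = n /\ inv3412_word w.
Proof.
split=> [/mapP[s + ->]|[<- [wlt winv wav]]].
  rewrite mem_enum inE => /andP[/forallP sinv sav]; split; first exact: size_word.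
  have nthE i (lti : i < n) : nth 0 (word s) i = s (Ordinal lti).
    by rewrite -nth_word.
  split; rewrite size_word.
  - by move=> i lti; rewrite nthE.
  - by move=> i lti; rewrite (nthE i lti) nth_word (eqP (sinv _)).
  - move=> i j k l ij jk kl ln; have kn := ltn_trans kl ln; have jn := ltn_trans jk kn.
    have iin := ltn_trans ij jn; rewrite !nthE => H1 H2 H3.
    case/existsP: sav; exists (Ordinal iin); apply/existsP; exists (Ordinal jn).
    apply/existsP; exists (Ordinal kn); apply/existsP; exists (Ordinal ln).
    by rewrite order_iso_3412 /= ij jk kl H1 H2 H3.
(* The letters of [w] define an involutive self-map of the positions, hence a permutation whose word
   is [w]. *)
pose f (i : 'I_(size w)) := Ordinal (wlt i (ltn_ord i)).
have fK : involutive f by move=> i; apply: val_inj; rewrite /= winv.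
have wE : w = word (perm (inv_inj fK)).
  apply: (eq_from_nth (x0 := 0)) => [|i lti]; first by rewrite size_word.
  by rewrite (nth_word _ (Ordinal lti)) permE.
rewrite [X in X \in _]wE; apply: map_f; rewrite mem_enum inE; apply/andP; split.
  by apply/forallP => i; rewrite !permE fK.
apply/existsP => -[i /existsP[j /existsP[k /existsP[l /and4P[ij jk kl]]]]].
rewrite order_iso_3412 !permE /= => /and3P[H1 H2 H3].
exact: (wav i j k l).
Qed.

(** Both sides are duplicate-free with the same members: a first letter 0 or positive separates the
    two kinds, and an arc word determines its two parts. *)
Lemma words_rec n : perm_eq (words n.+1)
  (map fixed_word (words n) ++
   [seq arc_word p.1 p.2 | k <- iota 0 n,
      p <- [seq (u, v) | u <- words k, v <- words (n.-1 - k)]]).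
Proof.
have arcs w : w \in [seq arc_word p.1 p.2 | k <- iota 0 n,
      p <- [seq (u, v) | u <- words k, v <- words (n.-1 - k)]] <->
    exists u v, [/\ size u + size v = n.-1, size u < n, inv3412_word u,
      inv3412_word v & w = arc_word u v].
  split=> [/allpairsPdep[k [_ [+ /allpairsPdep[u [v [uk vk ->]]] ->]]]|].
    rewrite mem_iota /= => kn; move/mem_words: uk => [su iu].
    by move/mem_words: vk => [sv iv]; exists u, v; split=> //; rewrite su ?sv; lia.
  move=> [u [v [suv su iu iv ->]]]; apply/allpairsPdep; exists (size u), (u, v).
  split=> //; first by rewrite mem_iota.
  by apply/allpairsPdep; exists u, v; split=> //; apply/mem_words; rewrite -?suv ?addKn.
apply: uniq_perm; first exact: uniq_words.
  rewrite cat_uniq map_inj_uniq ?uniq_words /=; last first.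
    by move=> u v [/inj_map]; apply=> a b [].
  apply/andP; split.
    apply/hasPn => _ /arcs[u [v [_ _ _ _ ->]]].
    by apply/mapP => -[].
  apply: allpairs_uniq_dep; first exact: iota_uniq.
    move=> k _; apply: allpairs_uniq; rewrite ?uniq_words // => -[? ?] [? ?] _ _.
    by case=> -> ->.
  move=> x1 x2 /allpairsPdep[k [_ [_ /allpairsPdep[u [v [uk _ ->]]] ->]]].
  move=> /allpairsPdep[k' [_ [_ /allpairsPdep[u' [v' [uk' _ ->]]] ->]]] /=.
  move=> /arc_word_inj[uu vv]; move/mem_words: uk => [<- _].
  by move/mem_words: uk' => [<- _]; rewrite uu vv.
move=> w; rewrite mem_cat; apply/idP/idP => [/mem_words[sw iw]|/orP[]].
- case: w sw iw => // -[|m] w [sw] iw.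
    have [w' iw' E] := inv3412_word_head0 iw.
    rewrite E map_f //; apply/mem_words; split=> //.
    by move: (congr1 size E); rewrite size_fixed_word /= sw => -[].
  have [u [v [iu iv E]]] := inv3412_word_headS iw.
  apply/orP; right; apply/arcs; exists u, v; split=> //;
  by move: (congr1 size E); rewrite size_arc_word /= sw; lia.
- move=> /mapP[w' /mem_words[sw' iw'] ->]; apply/mem_words.
  by split; [rewrite size_fixed_word sw' | apply: inv3412_fixed_word].
- move=> /arcs[u [v [suv su iu iv ->]]]; apply/mem_words.
  by split; [rewrite size_arc_word; lia | apply: inv3412_arc_word].
Qed.

(** * Generating functions and the quadratic equation *)

Local Open Scope ring_scope.

Lemma sum_words_rec (R : comNzRingType) (f : seq nat -> R) n :
  \sum_(w <- words n.+1) f w =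
  \sum_(w <- words n) f (fixed_word w) +
  \sum_(k < n) \sum_(u <- words k) \sum_(v <- words (n.-1 - k))
     f (arc_word u v).
Proof.
rewrite (perm_big _ (words_rec n)) big_cat big_map /=; congr (_ + _).
rewrite big_allpairs_dep -[n in iota 0 n]subn0 -/(index_iota 0 n) big_mkord.
by apply: eq_bigr => k _; rewrite big_allpairs_dep.
Qed.

(** Coefficient [n] sees only the terms of [f] up to degree [n]; truncating there moves the
    computation to polynomials, where [ring] applies. *)
Lemma fps_mul_poly (R : nzRingType) (p : {poly R}) (f : fps R) n :
  fps_mul (fps_of_poly p) f n = (p * \poly_(i < n.+1) f i)`_n.
Proof.
rewrite coefM; apply: eq_bigr => i _.
by rewrite coef_poly ltnS leq_subr.
Qed.

Section GeneratingFunction.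

Variables (R : comNzRingType) (t z : R).

Let wt (w : seq nat) : R := t ^+ occ312_word w * z ^+ fix_word 0 w.
Let gf (n : nat) : R := \sum_(w <- words n) wt w.
(** Weights for the word enclosed by an arc: the extra [t] records a 312 starting at the opening
    letter. *)
Let gf_arc (n : nat) : R := \sum_(w <- words n) t ^+ initial_ascent w * wt w.

Lemma sum_I3412_words n :
  \sum_(s in I3412 n) t ^+ occ312 s * z ^+ fixpts s = gf n.
Proof.
rewrite /gf big_map big_enum /=; apply: eq_bigr => s _.
by rewrite /wt occ312_wordE fixpts_wordE.
Qed.

Lemma wt_fixed_word w : wt (fixed_word w) = z * wt w.
Proof. by rewrite /wt occ312_fixed_word fix_fixed_word exprS mulrCA. Qed.

Lemma wt_arc_word k u v : u \in words k ->
  wt (arc_word u v) = (t ^+ initial_ascent u * wt u) * wt v.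
Proof.
move=> /mem_words[_ [ult _ _]].
rewrite /wt occ312_arc_word; last by apply/(all_nthP 0).
by rewrite fix_arc_word !exprD; ring.
Qed.

Lemma gf_rec n : gf n.+1 = z * gf n + \sum_(k < n) gf_arc k * gf (n.-1 - k).
Proof.
rewrite /gf sum_words_rec mulr_sumr; congr (_ + _).
  by apply: eq_bigr => w _; rewrite wt_fixed_word.
apply: eq_bigr => k _; rewrite mulr_suml big_seq [RHS]big_seq; apply: eq_bigr => u uk.
by rewrite mulr_sumr; apply: eq_bigr => v _; rewrite (wt_arc_word _ uk).
Qed.

Lemma words0 : words 0 = [:: [::]].
Proof.
apply: perm_small_eq => //; apply: uniq_perm; rewrite ?uniq_words // => w.
rewrite inE; apply/idP/eqP => [/mem_words[/size0nil]//|->].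
by apply/mem_words; split.
Qed.

Lemma gf0 : gf 0 = 1.
Proof. by rewrite /gf words0 big_seq1 /wt !expr0 mulr1. Qed.

Lemma gf_arc_small n : (n < 2)%N -> gf_arc n = gf n.
Proof.
move=> lt2; rewrite /gf_arc /gf !big_seq; apply: eq_bigr => w /mem_words[sw _].
by case: w sw => [|b [|c w]] /= sw; rewrite ?mul1r //; lia.
Qed.

(** The opening letter [(size u).+1] exceeds every letter of the shifted [u], as well as the closing
    0. *)
Lemma initial_ascent_arc_word k u v :
  u \in words k -> initial_ascent (arc_word u v) = false.
Proof.
move=> /mem_words[_ [ult _ _]]; case: u ult => [|b u] ult //=.
by apply/negbTE; rewrite -leqNgt ltnW // ltnS; apply: (ult 0%N).
Qed.

(* A word of [words k.+2] starts with an ascent iff its first letter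
   is a fixed point. *)
Lemma gf_arc_SS k : gf_arc k.+2 = gf k.+2 + (t - 1) * z * gf k.+1.
Proof.
rewrite /gf_arc /gf !(sum_words_rec _ k.+1) addrAC; congr (_ + _).
  rewrite mulr_sumr -big_split /= !big_seq; apply: eq_bigr => w /mem_words[sw _].
  rewrite wt_fixed_word; case: w sw => //= b w _.
  by rewrite expr1; ring.
apply: eq_bigr => j _; rewrite !big_seq; apply: eq_bigr => u uj.
by apply: eq_bigr => v _; rewrite (initial_ascent_arc_word _ uj) mul1r.
Qed.

Lemma gf_SS n : gf n.+2 = z * gf n.+1 + fps_mul gf_arc gf n.
Proof. exact: gf_rec. Qed.

(** With A the series of [gf_arc], this is AF = F^2 + (t - 1)xz(F - 1)F in degree [n.+1]. *)
Lemma fps_mul_gf_arc n :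
  fps_mul gf_arc gf n.+1 = fps_mul gf gf n.+1 + (t - 1) * z * (fps_mul gf gf n - gf n).
Proof.
(* Degrees 0 and 1, where A and F agree, are split off; the first term of the shorter convolution is
   [gf n], which cancels the subtracted one. *)
rewrite /fps_mul !(@big_ord_recl _ _ _ n.+1) !(@big_ord_recl _ _ _ n) /=.
rewrite !gf_arc_small // gf0 !subn0 mul1r.
have -> : \sum_(i < n) gf_arc (bump 0 (bump 0 i)) * gf (n.+1 - bump 0 (bump 0 i)) =
    \sum_(i < n) gf (bump 0 (bump 0 i)) * gf (n.+1 - bump 0 (bump 0 i)) +
    (t - 1) * z * \sum_(i < n) gf (bump 0 i) * gf (n - bump 0 i).
  rewrite mulr_sumr -big_split /=; apply: eq_bigr => i _.
  by rewrite /bump !leq0n !add1n gf_arc_SS subSS; ring.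
by ring.
Qed.

Lemma gf_quadratic :
  let x : {poly R} := 'X in
  let a := x ^+ 3 * z%:P * t%:P + x ^+ 2 - x ^+ 3 * z%:P in
  let b := x * z%:P + x ^+ 2 + x ^+ 3 * z%:P - x ^+ 3 * z%:P * t%:P
           - x ^+ 2 - 1 in
  fps_mul (fps_of_poly a) (fps_mul gf gf) \+ fps_mul (fps_of_poly b) gf
    \+ fps_of_poly 1 =1 fps_of_poly 0.
Proof.
move=> x a b n /=; rewrite !fps_mul_poly /fps_of_poly -!coefD.
set Q := \poly_(i < n.+1) _; set P := \poly_(i < n.+1) _.
have QE i : (i <= n)%N -> Q`_i = fps_mul gf gf i by rewrite coef_poly ltnS => ->.
have PE i : (i <= n)%N -> P`_i = gf i by rewrite coef_poly ltnS => ->.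
(* Grouped by powers of ['X], so that coefficients become index shifts; the two squares of [x] in
   [b] cancel. *)
have -> : a * Q + b * P + 1 = 'X^2 * Q + 'X^3 * ((z * t - z)%:P * Q) +
    'X^1 * (z%:P * P) + 'X^3 * ((z - z * t)%:P * P) - P + 1.
  by rewrite /a /b !(polyCB, polyCM) -/x; ring.
rewrite !(coefD, coefB, coefN, coefXnM, coefCM, coef1, coef0).
(* Degrees 0, 1 and 2 are initial cases: the cubic terms and [fps_mul_gf_arc] enter only from degree
   3 on. *)
case: n Q P QE PE => [|[|[|n]]] Q P QE PE; rewrite ?subn0 ?subSS ?subn0 /=.
- by rewrite PE // gf0; ring.
- by rewrite !PE // gf_rec big_ord0; ring.
- by rewrite !PE // QE // gf_SS /fps_mul !big_ord1 gf_arc_small //; ring.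
- by rewrite !PE ?QE //; try lia; rewrite (gf_SS n.+1) fps_mul_gf_arc; ring.
Qed.

End GeneratingFunction.

Theorem theorem4p5 :
  let x : {poly Ztz} := 'X in
  let t : {poly Ztz} := t_var%:P in
  let z : {poly Ztz} := z_var%:P in
  let a : {poly Ztz} := x ^+ 3 * z * t + x ^+ 2 - x ^+ 3 * z in
  let b : {poly Ztz} :=
    x * z + x ^+ 2 + x ^+ 3 * z - x ^+ 3 * z * t - x ^+ 2 - 1 in
  let c : {poly Ztz} := 1 in
  fps_mul (fps_of_poly a) (fps_mul F312 F312)
    \+ fps_mul (fps_of_poly b) F312
    \+ fps_of_poly c
  =1 fps_of_poly 0.
Proof.
move=> x t z a b c n; rewrite -(gf_quadratic t_var z_var n) /=.
congr (_ + _ + _); apply: eq_bigr => i _; congr (_ * _).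
  by apply: eq_bigr => j _; congr (_ * _); apply: sum_I3412_words.
exact: sum_I3412_words.
Qed.
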